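(* Consider $k\ge 2$ coupled circuit DAEs, i.e. for $i=1,\dots,k$ $$0=A_{C_i}\tfrac{d}{dt}q_i(A_{C_i}^\top e_i)+A_{R_i}g_i(A_{R_i}^\top e_i)+A_{L_i}\jmath_{L_i}+A_{V_i}\jmath_{V_i}+A_{I_i}\imath_i(t)+A_{\lambda_i}\lambda,$$ $$0=\tfrac{d}{dt}\phi_i(\jmath_{L_i})-A_{L_i}^\top e_i,\qquad 0=A_{V_i}^\top e_i-v_i(t),$$ together with the linear coupling equation $$0=\sum_{i=1}^kA_{\lambda_i}^\top e_i,$$ where the overall circuit satisfies the soundness and passivity assumptions. Then these coupled circuit DAEs define (that is, can be written as) $k$ multiply coupled PH-DAE systems.
   Context: PH-DAE. A system $\frac{d}{dt}Ex(t)=Jz(x(t))-r(z(x(t)))+Bu(t)$, $y(t)=B^\top z(x(t))$ with $E\in\mathbb{R}^{p\times n}$, $J\in\mathbb{R}^{p\times p}$, $B\in\mathbb{R}^{p\times m}$, $z:\mathbb{R}^n\to\mathbb{R}^p$, $r:\mathbb{R}^p\to\mathbb{R}^p$ is a port-Hamiltonian DAE (PH-DAE) if there exist a subspace $\mathcal V\subset\mathbb{R}^p$ and $H\in C^1(\mathbb{R}^n,\mathbb{R})$ (the Hamiltonian) such that: (i) for all intervals $\mathcal I\subset\mathbb{R}$ and all $u:\mathcal I\to\mathbb{R}^m$ for which the system has a solution $x:\mathcal I\to\mathbb{R}^n$, $z(x(t))\in\mathcal V$ for all $t\in\mathcal I$; (ii) $v^\top Jw=-w^\top Jv$ for all $v,w\in\mathcal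 V$; (iii) $v^\top r(v)\ge0$ for all $v\in\mathcal V$; (iv) $\nabla H(x)=E^\top z(x)$ for all $x\in z^{-1}(\mathcal V)$. Multiply coupled PH-DAE. This consists of $k$ PH-DAEs $\frac{d}{dt}E_ix_i=J_iz_i(x_i)-r_i(z_i(x_i))+B_iu_i$, $y_i=B_i^\top z_i(x_i)$ with Hamiltonians $H_i$ ($i=1,\dots,k$), whose inputs and outputs are split as $u_i=(\hat u_i^\top,\bar u_i^\top)^\top$, $y_i=(\hat y_i^\top,\bar y_i^\top)^\top$, with $B_i=(\hat B_i\ \bar B_i)$ split accordingly (hat: used for the coupling of the subsystems; bar: external, not communicated to other subsystems). The subsystems are coupled by $\hat u_i+\sum_{j\neq i}\hat C_{i,j}\hat y_j=0$ ($i=1,\dots,k$) with matrices $\hat C_{i,j}$ having entries in $\{-1,0,1\}$, and the block matrix $\hat C$ with off-diagonal blocks $\hat C_{i,j}$ and zero diagonal blocks is skew-symmetric. Circuits. The $i$th subcircuit is a finite loop-free directed graph whose edges are capacitances, resistances, inductances, voltage sources and current sources; $A_{C_i},A_{R_i},A_{L_i},A_{V_i},A_{I_i}$ are the columns of its (grounded) incidence matrix belonging to the respective component types; $q_i,\phi_i,g_i$ are its charge, flux and conductance functions; $e_i$ are vertex potentials, $\jmath_{L_i},\jmath_{V_i}$ currents through inductances and voltage sources, $\imath_i(t),v_i(t)$ given current and voltage sources. The subcircuits are joined by $n_\lambda$ coupling edges carrying artificial voltage sources with zero voltage drop and currents $\lambda(t)\in\mathbb{R}^{n_\lambda}$; $A_{\lambda_i}$,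 with entries in $\{-1,0,1\}$ and $n_\lambda$ columns, is the incidence matrix of these artificial voltage sources in subcircuit $i$. In writing the equations as $k$ subsystems, the coupling equation is added to one of the subsystems, without loss of generality the last one. Soundness: the overall circuit graph has at least one edge, is connected, and contains no cycle consisting only of voltage source edges and no cut consisting only of current source edges. Passivity: all $q_i$ and $\phi_i$ (self-maps of Euclidean spaces of the appropriate dimension) are bijective and continuously differentiable with everywhere symmetric positive definite Jacobians; each $g_i$ is continuously differentiable and the sum of its Jacobian and the transpose of its Jacobian is everywhere positive definite.
   Formalization: Passivity does not force g_i(0)=0, without which the dissipation condition can fail; when g_i(0) is nonzero, the external input of subsystem i is the given sources plus an added constant source, and when g_i(0)=0 it is exactly the current and voltage sources. *)

(* Defs.v *)
From HB Require Import structures.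
From mathcomp Require Import all_boot all_order all_algebra.
From mathcomp Require Import all_classical all_reals all_analysis.

Set Implicit Arguments.
Unset Strict Implicit.
Unset Printing Implicit Defensive.

Import Order.TTheory GRing.Theory Num.Theory.
Import numFieldNormedType.Exports.

Local Open Scope classical_set_scope.
Local Open Scope ring_scope.

(* Degenerate intervals are excluded: on a one-point interval the derivative
   along the interval has no meaning. *)
Definition time_interval (R : realType) (I : set R) : Prop :=
  is_interval I /\ exists s t, [/\ I s, I t & s < t].

(* Derivative at t of the restriction of f to I; it is one-sided at an endpoint
   of I, and the values of f outside I play no role. *)
Definition has_deriv_in (R : realType) (n : nat) (I : set R)
    (f : R -> 'cV[R]_n) (t : R) (d : 'cV[R]_n) : Prop :=
  (fun s => (s - t)^-1 *: (f s - f t)) @ within I t^' --> d.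

(* The library's jacobian is for row vectors and is transposed w.r.t. this. *)
Definition jacob (R : realType) (n m : nat) (f : 'cV[R]_n -> 'cV[R]_m)
    (x : 'cV[R]_n) : 'M[R]_(m, n) :=
  \matrix_(i, j) ('D_(delta_mx j 0) f x) i 0.

Definition grad (R : realType) (n : nat) (H : 'cV[R]_n -> R)
    (x : 'cV[R]_n) : 'cV[R]_n :=
  \col_j 'D_(delta_mx j 0) H x.

Definition C1_map (R : realType) (n m : nat) (f : 'cV[R]_n -> 'cV[R]_m) : Prop :=
  (forall x, differentiable f x) /\ continuous (jacob f).

Definition C1_scalar (R : realType) (n : nat) (H : 'cV[R]_n -> R) : Prop :=
  (forall x, differentiable H x) /\ continuous (grad H).

Definition posdef (R : realType) (n : nat) (M : 'M[R]_n) : Prop :=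
  forall v : 'cV[R]_n, v != 0 -> 0 < (v^T *m M *m v) 0 0.

Record ph_system (R : realType) (n p m : nat) := PHSystem {
  ph_E : 'M[R]_(p, n);
  ph_J : 'M[R]_p;
  ph_B : 'M[R]_(p, m);
  ph_z : 'cV[R]_n -> 'cV[R]_p;
  ph_r : 'cV[R]_p -> 'cV[R]_p }.

Definition ph_solution (R : realType) (n p m : nat) (S : ph_system R n p m)
    (I : set R) (u : R -> 'cV[R]_m) (x : R -> 'cV[R]_n) : Prop :=
  forall t, I t ->
    has_deriv_in I (fun s => ph_E S *m x s) t
      (ph_J S *m ph_z S (x t) - ph_r S (ph_z S (x t)) + ph_B S *m u t).

Definition ph_output (R : realType) (n p m : nat) (S : ph_system R n p m)
    (x : 'cV[R]_n) : 'cV[R]_m := (ph_B S)^T *m ph_z S x.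

Definition is_ph_dae (R : realType) (n p m : nat) (S : ph_system R n p m) : Prop :=
  exists (V : {vspace 'cV[R]_p}) (H : 'cV[R]_n -> R),
    C1_scalar H /\
    [/\ forall (I : set R) (u : R -> 'cV[R]_m) (x : R -> 'cV[R]_n),
          time_interval I -> ph_solution S I u x ->
          forall t, I t -> ph_z S (x t) \in V,
        forall v w, v \in V -> w \in V ->
          v^T *m ph_J S *m w = - (w^T *m ph_J S *m v),
        forall v, v \in V -> 0 <= (v^T *m ph_r S v) 0 0
      & forall x, ph_z S x \in V -> grad H x = (ph_E S)^T *m ph_z S x].

(* The input of system i is col_mx u_hat u_bar, of size mh i + mb i. *)
Definition coupling_output (R : realType) (n p mh mb : nat)
    (S : ph_system R n p (mh + mb)) (x : 'cV[R]_n) : 'cV[R]_mh :=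
  usubmx (ph_output S x).

Definition is_coupling_matrix (R : realType) (k : nat) (mh : 'I_k -> nat)
    (C : forall i j : 'I_k, 'M[R]_(mh i, mh j)) : Prop :=
  [/\ forall i j a b, i != j -> C i j a b \in [:: -1; 0; 1],
      forall i, C i i = 0
    & (\mxblock_(i, j) C i j)^T = - \mxblock_(i, j) C i j].

Definition multiply_coupled_ph (R : realType) (k : nat)
    (n p mh mb : 'I_k -> nat)
    (S : forall i, ph_system R (n i) (p i) (mh i + mb i))
    (C : forall i j : 'I_k, 'M[R]_(mh i, mh j)) : Prop :=
  (forall i, is_ph_dae (S i)) /\ is_coupling_matrix C.

Definition coupled_ph_solution (R : realType) (k : nat)
    (n p mh mb : 'I_k -> nat)
    (S : forall i, ph_system R (n i) (p i) (mh i + mb i))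
    (C : forall i j : 'I_k, 'M[R]_(mh i, mh j))
    (I : set R) (ubar : forall i, R -> 'cV[R]_(mb i))
    (x : forall i, R -> 'cV[R]_(n i)) : Prop :=
  exists uhat : forall i, R -> 'cV[R]_(mh i),
    (forall i, ph_solution (S i) I (fun t => col_mx (uhat i t) (ubar i t)) (x i)) /\
    (forall i t, I t ->
       uhat i t + \sum_(j | j != i) C i j *m coupling_output (S j) (x j t) = 0).

Record digraph (V E : finType) := Digraph { src : E -> V; tgt : E -> V }.

Definition joins (V E : finType) (G : digraph V E) (e : E) (u v : V) : bool :=
  ((src G e == u) && (tgt G e == v)) || ((src G e == v) && (tgt G e == u)).

(* Connectedness, orientation ignored, after deleting the edges of K. *)
Definition connected_without (V E : finType) (G : digraph V E) (K : {set E}) : Prop :=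
  forall u v, connect (fun a b => [exists e, (e \notin K) && joins G e a b]) u v.

(* es joins each vertex of vs to its cyclic successor; two parallel edges form
   a cycle. *)
Definition is_cycle (V E : finType) (G : digraph V E) (vs : seq V) (es : seq E) : Prop :=
  [/\ (0 < size es)%N, size vs = size es, uniq vs, uniq es
    & all (fun a => joins G a.1 a.2.1 a.2.2) (zip es (zip vs (rot 1 vs)))].

(* K is a minimal set of edges whose deletion disconnects G. *)
Definition is_cut (V E : finType) (G : digraph V E) (K : {set E}) : Prop :=
  ~ connected_without G K /\
  forall K' : {set E}, K' \proper K -> connected_without G K'.

Definition branch (nC nR nL nV nI : nat) : finType :=
  ('I_nC + 'I_nR + 'I_nL + 'I_nV + 'I_nI)%type.

(* A vertex is None (the ground) or Some v with v one of the nv other vertices. *)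
Record subcircuit (R : realType) := Subcircuit {
  nv : nat; nC : nat; nR : nat; nL : nat; nV : nat; nI : nat;
  sub_graph : digraph (option 'I_nv) (branch nC nR nL nV nI);
  sub_loop_free : forall b, src sub_graph b != tgt sub_graph b;
  charge : 'cV[R]_nC -> 'cV[R]_nC;
  flux : 'cV[R]_nL -> 'cV[R]_nL;
  conductance : 'cV[R]_nR -> 'cV[R]_nR }.

(* Columns, at the edges (emb j), of the incidence matrix without ground row. *)
Definition incidence (R : realType) (s : subcircuit R) (m : nat)
    (emb : 'I_m -> branch (nC s) (nR s) (nL s) (nV s) (nI s)) : 'M[R]_(nv s, m) :=
  \matrix_(v, j) ((src (sub_graph s) (emb j) == Some v)%:R
                  - (tgt (sub_graph s) (emb j) == Some v)%:R).

Definition A_C (R : realType) (s : subcircuit R) : 'M[R]_(nv s, nC s) :=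
  incidence (fun j => inl (inl (inl (inl j)))).
Definition A_R (R : realType) (s : subcircuit R) : 'M[R]_(nv s, nR s) :=
  incidence (fun j => inl (inl (inl (inr j)))).
Definition A_L (R : realType) (s : subcircuit R) : 'M[R]_(nv s, nL s) :=
  incidence (fun j => inl (inl (inr j))).
Definition A_V (R : realType) (s : subcircuit R) : 'M[R]_(nv s, nV s) :=
  incidence (fun j => inl (inr j)).
Definition A_I (R : realType) (s : subcircuit R) : 'M[R]_(nv s, nI s) :=
  incidence (fun j => inr j).

(* All subcircuits share one ground vertex, None. *)
Definition vertex (R : realType) (k : nat) (sub : 'I_k -> subcircuit R) : finType :=
  option {i : 'I_k & 'I_(nv (sub i))}.

Record coupled_circuit (R : realType) (k : nat) := CoupledCircuit {
  sub : 'I_k -> subcircuit R;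
  nlam : nat;
  lam_graph : digraph (vertex sub) 'I_nlam;
  lam_loop_free : forall j, src lam_graph j != tgt lam_graph j }.

Definition A_lam (R : realType) (k : nat) (cc : coupled_circuit R k) (i : 'I_k) :
    'M[R]_(nv (sub cc i), nlam cc) :=
  \matrix_(v, j)
    ((src (lam_graph cc) j == Some (Tagged (fun i => 'I_(nv (sub cc i))) v))%:R
     - (tgt (lam_graph cc) j == Some (Tagged (fun i => 'I_(nv (sub cc i))) v))%:R).

Definition sub_branch (R : realType) (k : nat) (cc : coupled_circuit R k)
    (i : 'I_k) : finType :=
  branch (nC (sub cc i)) (nR (sub cc i)) (nL (sub cc i)) (nV (sub cc i))
    (nI (sub cc i)).

Definition edge (R : realType) (k : nat) (cc : coupled_circuit R k) : finType :=
  ({i : 'I_k & sub_branch cc i} + 'I_(nlam cc))%type.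

Definition lift_vertex (R : realType) (k : nat) (cc : coupled_circuit R k)
    (i : 'I_k) (v : option 'I_(nv (sub cc i))) : vertex (sub cc) :=
  omap (Tagged (fun i => 'I_(nv (sub cc i)))) v.

Definition overall_graph (R : realType) (k : nat) (cc : coupled_circuit R k) :
    digraph (vertex (sub cc)) (edge cc) :=
  Digraph
    (fun b : edge cc => match b with
       | inl (existT i b) => lift_vertex (src (sub_graph (sub cc i)) b)
       | inr j => src (lam_graph cc) j end)
    (fun b : edge cc => match b with
       | inl (existT i b) => lift_vertex (tgt (sub_graph (sub cc i)) b)
       | inr j => tgt (lam_graph cc) j end).

(* The coupling edges carry (artificial) voltage sources. *)
Definition is_voltage_edge (R : realType) (k : nat) (cc : coupled_circuit R k)
    (b : edge cc) : bool :=
  match b with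
  | inl (existT i (inl (inr _))) => true
  | inr _ => true
  | _ => false
  end.

Definition is_current_edge (R : realType) (k : nat) (cc : coupled_circuit R k)
    (b : edge cc) : bool :=
  match b with
  | inl (existT i (inr _)) => true
  | _ => false
  end.

Definition sound (R : realType) (k : nat) (cc : coupled_circuit R k) : Prop :=
  [/\ (0 < #|edge cc|)%N,
      connected_without (overall_graph cc) finset.set0,
      ~ (exists vs es, is_cycle (overall_graph cc) vs es /\
                       all (@is_voltage_edge R k cc) es)
    & ~ (exists K : {set edge cc}, is_cut (overall_graph cc) K /\
                       forall b, b \in K -> is_current_edge b)].

Definition passive (R : realType) (s : subcircuit R) : Prop :=
  [/\ [/\ bijective (@charge R s), C1_map (@charge R s)
        & forall v, (jacob (@charge R s) v)^T = jacob (@charge R s) v /\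
                    posdef (jacob (@charge R s) v)],
      [/\ bijective (@flux R s), C1_map (@flux R s)
        & forall v, (jacob (@flux R s) v)^T = jacob (@flux R s) v /\
                    posdef (jacob (@flux R s) v)]
    & C1_map (@conductance R s) /\
      forall v, posdef (jacob (@conductance R s) v
                        + (jacob (@conductance R s) v)^T)].

Definition circuit_solution (R : realType) (k : nat) (cc : coupled_circuit R k)
    (I : set R)
    (cur : forall i, R -> 'cV[R]_(nI (sub cc i)))
    (vol : forall i, R -> 'cV[R]_(nV (sub cc i)))
    (e : forall i, R -> 'cV[R]_(nv (sub cc i)))
    (jL : forall i, R -> 'cV[R]_(nL (sub cc i)))
    (jV : forall i, R -> 'cV[R]_(nV (sub cc i)))
    (lam : R -> 'cV[R]_(nlam cc)) : Prop :=
  forall t, I t ->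
    (forall i,
       let s := sub cc i in
       [/\ exists dq,
             has_deriv_in I (fun t => charge ((A_C s)^T *m e i t)) t dq /\
             0 = A_C s *m dq + A_R s *m conductance ((A_R s)^T *m e i t)
                 + A_L s *m jL i t + A_V s *m jV i t + A_I s *m cur i t
                 + A_lam cc i *m lam t,
           exists dphi,
             has_deriv_in I (fun t => flux (jL i t)) t dphi /\
             0 = dphi - (A_L s)^T *m e i t
         & 0 = (A_V s)^T *m e i t - vol i t]) /\
    0 = \sum_i (A_lam cc i)^T *m e i t.

(* External input of system i: the current and voltage sources of subcircuit i,
   followed by a constant source c i. Monotonicity of the conductance g does not
   give 0 <= v^T g(v) unless g(0) = 0; c i is there to carry the constant
   currents g(0) otherwise, as in g(v) = (g(v) - g(0)) + g(0). *)
Definition external_input (R : realType) (k : nat) (cc : coupled_circuit R k)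
    (nc : 'I_k -> nat) (c : forall i, 'cV[R]_(nc i))
    (cur : forall i, R -> 'cV[R]_(nI (sub cc i)))
    (vol : forall i, R -> 'cV[R]_(nV (sub cc i))) (i : 'I_k) (t : R) :
    'cV[R]_(nI (sub cc i) + nV (sub cc i) + nc i) :=
  col_mx (col_mx (cur i t) (vol i t)) (c i).

(* The coupled systems S are a rewriting of the circuit equations, system l
   being the one that takes over the coupling equation and hence lam: the
   circuit variables of subcircuit i are read off pointwise from the state of
   system i, and lam from the state of system l; the coupling outputs are the
   voltages seen by the coupling edges for i != l, and the currents lam for l;
   the read-out is a bijection between the solutions on every interval. *)
Definition rewrites_circuit (R : realType) (k : nat) (l : 'I_k)
    (cc : coupled_circuit R k) (n p nc : 'I_k -> nat)
    (c : forall i, 'cV[R]_(nc i))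
    (S : forall i, ph_system R (n i) (p i)
           (nlam cc + (nI (sub cc i) + nV (sub cc i) + nc i)))
    (C : forall i j : 'I_k, 'M[R]_(nlam cc, nlam cc)) : Prop :=
  exists (re : forall i, 'cV[R]_(n i) -> 'cV[R]_(nv (sub cc i)))
         (rL : forall i, 'cV[R]_(n i) -> 'cV[R]_(nL (sub cc i)))
         (rV : forall i, 'cV[R]_(n i) -> 'cV[R]_(nV (sub cc i)))
         (rlam : 'cV[R]_(n l) -> 'cV[R]_(nlam cc)),
  [/\ forall i x, i != l ->
        coupling_output (S i) x = (A_lam cc i)^T *m re i x,
      forall x, coupling_output (S l) x = rlam x
    & forall (I : set R)
        (cur : forall i, R -> 'cV[R]_(nI (sub cc i)))
        (vol : forall i, R -> 'cV[R]_(nV (sub cc i))),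
      time_interval I ->
      let ph_sol (x : forall i, R -> 'cV[R]_(n i)) :=
        coupled_ph_solution (mh := fun=> nlam cc) S C I
          (external_input c cur vol) x in
      (forall x, ph_sol x ->
         circuit_solution I cur vol
           (fun i t => re i (x i t)) (fun i t => rL i (x i t))
           (fun i t => rV i (x i t)) (fun t => rlam (x l t))) /\
      (forall e jL jV lam, circuit_solution I cur vol e jL jV lam ->
         let reads (x : forall i, R -> 'cV[R]_(n i)) := forall t, I t ->
           (forall i, [/\ re i (x i t) = e i t, rL i (x i t) = jL i t
                        & rV i (x i t) = jV i t]) /\
           rlam (x l t) = lam t in
         exists x, [/\ ph_sol x, reads x
           & forall x', ph_sol x' -> reads x' ->
             forall i t, I t -> x' i t = x i t])].

(* Main.v *)
Require Import Defs.
From HB Require Import structures.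
From mathcomp Require Import all_boot all_order all_algebra.
From mathcomp Require Import all_classical all_reals all_analysis.
From mathcomp Require Import ring lra.

(* Subcircuit i gets the state x = (q_C, phi_L, e, j_V, j_C, mu), where j_C is
   the capacitor current and mu is lambda for i = l and void for i <> l, the
   effort z(x) = (q^-1(q_C), phi^-1(phi_L), e, j_V, j_C, mu) and E = diag(1, 1, 0).
   Having j_C in the state makes J skew-symmetric on the whole space and makes
   q_C itself differentiable rather than only A_C q_C; so V is the whole space.
   System l sends the coupling currents lambda to the other systems and receives
   their voltages A_lambda^T e, so C has the blocks 1 and -1 in column and row l.

   The energies must have gradients q^-1 and phi^-1. The Jacobian of q being
   symmetric, q has a potential W, given by line integrals from 0. As q is
   monotone, W is convex, and the Legendre transform of W has gradient q^-1 as
   soon as q^-1 is continuous, which follows from strict monotonicity. *)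

Set Implicit Arguments.
Unset Strict Implicit.
Unset Printing Implicit Defensive.

Import Order.TTheory GRing.Theory Num.Theory.
Import numFieldNormedType.Exports.

Local Open Scope classical_set_scope.
Local Open Scope ring_scope.

(** * Monotone maps and their potentials *)

Definition dotv (R : realType) (n : nat) (u v : 'cV[R]_n) : R := (u^T *m v) 0 0.

Lemma dotvE (R : realType) n (u v : 'cV[R]_n) : dotv u v = \sum_i u i 0 * v i 0.
Proof. by rewrite /dotv mxE; apply: eq_bigr => i _; rewrite mxE. Qed.

Lemma dotvC (R : realType) n (u v : 'cV[R]_n) : dotv u v = dotv v u.
Proof. by rewrite !dotvE; apply: eq_bigr => i _; rewrite mulrC. Qed.

Lemma dotvDr (R : realType) n (u v w : 'cV[R]_n) :
  dotv u (v + w) = dotv u v + dotv u w.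
Proof. by rewrite /dotv mulmxDr mxE. Qed.

Lemma dotvBr (R : realType) n (u v w : 'cV[R]_n) :
  dotv u (v - w) = dotv u v - dotv u w.
Proof. by rewrite /dotv mulmxBr !mxE. Qed.

Lemma dotvBl (R : realType) n (u v w : 'cV[R]_n) :
  dotv (u - v) w = dotv u w - dotv v w.
Proof. by rewrite dotvC dotvBr !(dotvC w). Qed.

Lemma dotvZr (R : realType) n a (u v : 'cV[R]_n) : dotv u (a *: v) = a * dotv u v.
Proof. by rewrite /dotv -scalemxAr mxE. Qed.

Lemma dotvZl (R : realType) n a (u v : 'cV[R]_n) : dotv (a *: u) v = a * dotv u v.
Proof. by rewrite dotvC dotvZr dotvC. Qed.

Lemma dotv_mull (R : realType) n m (A : 'M[R]_(m, n)) u v :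
  dotv (A *m u) v = dotv u (A^T *m v).
Proof. by rewrite /dotv trmx_mul mulmxA. Qed.

Lemma dotv_delta (R : realType) n (u : 'cV[R]_n) j : dotv u (delta_mx j 0) = u j 0.
Proof. by rewrite /dotv -colE !mxE. Qed.

(** * Norms and entrywise limits of matrices *)

Lemma mx_entry_le_norm (R : realType) m n (A : 'M[R]_(m, n)) i j : `|A i j| <= `|A|.
Proof. by rewrite [leRHS]/Num.norm /= mx_normrE (le_bigmax _ _ (i, j)). Qed.

Lemma dotv_norm_le (R : realType) n (u v : 'cV[R]_n) :
  `|dotv u v| <= n%:R * (`|u| * `|v|).
Proof.
rewrite dotvE (le_trans (ler_norm_sum _ _ _))//.
rewrite (_ : n%:R * _ = \sum_(i < n) (`|u| * `|v|)); last first.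
  by rewrite sumr_const card_ord mulr_natl.
by apply: ler_sum => i _; rewrite normrM ler_pM// mx_entry_le_norm.
Qed.

Lemma cvg_mx (R : realType) (T : Type) (F : set_system T) {FF : Filter F}
    m n (f : T -> 'M[R]_(m, n)) (l : 'M[R]_(m, n)) :
  (forall i j, f x i j @[x --> F] --> l i j) -> f @ F --> l.
Proof.
move=> fl; apply/cvgrPdist_lt => e e0.
have : \forall x \near F, forall ij : 'I_m * 'I_n, `|l ij.1 ij.2 - f x ij.1 ij.2| < e.
  by apply: filter_forall => -[i j]; move/cvgrPdist_lt : (fl i j); apply.
apply: filterS => x fx.
rewrite [ltLHS]/Num.norm /= mx_normrE; apply/bigmax_ltP; split=> // ij _.
by rewrite !mxE; exact: fx.
Qed.

Lemma cvg_mx_entry (R : realType) (T : Type) (F : set_system T) {FF : Filter F}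
    m n (f : T -> 'M[R]_(m, n)) (l : 'M[R]_(m, n)) i j :
  f @ F --> l -> f x i j @[x --> F] --> l i j.
Proof.
move=> fl.
exact: (@cvg_comp _ _ _ f (fun M => M i j) F _ _ fl (@coord_continuous _ _ _ i j l)).
Qed.

Lemma cvg_mulmx (R : realType) (T : Type) (F : set_system T) {FF : Filter F}
    m n p (f : T -> 'M[R]_(m, n)) (g : T -> 'M[R]_(n, p))
    (a : 'M[R]_(m, n)) (b : 'M[R]_(n, p)) :
  f @ F --> a -> g @ F --> b -> f x *m g x @[x --> F] --> a *m b.
Proof.
move=> fa gb; apply: cvg_mx => i j.
under eq_fun do rewrite mxE.
rewrite mxE; apply: cvg_big; first exact: add_continuous.
by move=> k _; apply: cvgM; exact: cvg_mx_entry.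
Qed.

Lemma cvg_dotv (R : realType) (T : Type) (F : set_system T) {FF : Filter F}
    n (f g : T -> 'cV[R]_n) (a b : 'cV[R]_n) :
  f @ F --> a -> g @ F --> b -> dotv (f x) (g x) @[x --> F] --> dotv a b.
Proof.
move=> fa gb; apply: (@cvg_mx_entry R T F FF 1 1 (fun x => (f x)^T *m g x) (a^T *m b)).
apply: cvg_mulmx gb.
by apply: cvg_mx => i j; under eq_fun do rewrite mxE; rewrite mxE; exact: cvg_mx_entry.
Qed.

Lemma mulmx_continuous (R : realType) m n p (A : 'M[R]_(m, n)) :
  continuous (fun X : 'M[R]_(n, p) => A *m X).
Proof.
by move=> X; apply: (@cvg_mulmx _ _ (nbhs X) _ _ _ _ (fun=> A) id); first exact: cvg_cst.
Qed.

(** * Derivatives along lines and of dot products *)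

Lemma jacob_mul (R : realType) n m (f : 'cV[R]_n -> 'cV[R]_m) x v :
  differentiable f x -> jacob f x *m v = 'D_v f x.
Proof.
move=> fx; rewrite deriveE//.
have -> : v = \sum_j v j 0 *: delta_mx j 0.
  by rewrite {1}[v]matrix_sum_delta; apply: eq_bigr => j _; rewrite big_ord1.
rewrite mulmx_sumr linear_sum; apply: eq_bigr => j _.
rewrite -scalemxAr linearZ; congr (_ *: _).
rewrite -colE; apply/colP => i; rewrite !mxE deriveE//.
Qed.

Lemma is_derive_line (R : realType) n m (f : 'cV[R]_n -> 'cV[R]_m) a b (t : R) :
  (forall x, differentiable f x) ->
  is_derive t 1 (fun t => f (a + t *: b)) (jacob f (a + t *: b) *m b).
Proof.
move=> df; rewrite jacob_mul//.
(* The difference quotient along the line is literally that of [f] at [a + t *: b] in direction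
   [b]. *)
have dq : (fun h : R => h^-1 *: (((fun t => f (a + t *: b)) \o shift t) (h *: 1)
            - f (a + t *: b))) =
          (fun h : R => h^-1 *: ((f \o shift (a + t *: b)) (h *: b) - f (a + t *: b))).
  apply/funext => h /=; congr (_ *: (f _ - _)).
  by rewrite /shift /= [h%:A]mulr1 scalerDl addrCA addrA.
have fd : derivable f (a + t *: b) b by exact: diff_derivable.
by apply: DeriveDef; rewrite /derivable ?/derive /= dq.
Qed.

Lemma is_derive_cV (R : realType) n (u : R -> 'cV[R]_n) (t : R) (du : 'cV[R]_n) :
  is_derive t 1 u du <-> forall i, is_derive t 1 (fun t => u t i 0) (du i 0).
Proof.
split=> [[du1 du2] i|h].
  have := derive_mx du1; rewrite du2 => ->; rewrite mxE.
  by apply: derivableP; exact: (derivable_mxP _ _ _).1.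
have du1 : derivable u t 1.
  by apply/derivable_mxP => i j; rewrite ord1; case: (h i).
apply: DeriveDef => //; rewrite derive_mx//.
by apply/colP => i; rewrite mxE; case: (h i).
Qed.

Lemma is_derive_dotv (R : realType) n (u v : R -> 'cV[R]_n) (t : R) (du dv : 'cV[R]_n) :
  is_derive t 1 u du -> is_derive t 1 v dv ->
  is_derive t 1 (fun t => dotv (u t) (v t)) (dotv du (v t) + dotv (u t) dv).
Proof.
move=> /is_derive_cV hu /is_derive_cV hv.
rewrite (_ : (fun _ => _) = \sum_i (fun t => u t i 0 * v t i 0)); last first.
  by apply/funext => s; rewrite dotvE fct_sumE.
rewrite !dotvE -big_split/=.
apply: is_derive_sum => i; apply: is_derive_eq.
rewrite addrC [in LHS]/GRing.scale/= mulrC; congr (_ + _).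
by rewrite mulrC.
Qed.

(** * Strict monotonicity and continuity of the inverse *)

Lemma dotv0r (R : realType) n (u : 'cV[R]_n) : dotv u 0 = 0.
Proof. by rewrite /dotv mulmx0 mxE. Qed.

(** Mean value theorem on [0, 1] for t |-> <f(y + t d), d> with d = x - y, whose derivative is the
    quadratic form of the Jacobian at d. *)
Lemma strictly_monotone_jacob (R : realType) n (f : 'cV[R]_n -> 'cV[R]_n) :
  (forall x, differentiable f x) ->
  (forall x (v : 'cV[R]_n), v != 0 -> 0 < dotv v (jacob f x *m v)) ->
  forall x y : 'cV[R]_n, x != y -> 0 < dotv (f x - f y) (x - y).
Proof.
move=> df pf x y xy; set d : 'cV[R]_n := x - y.
pose phi (t : R) := dotv (f (y + t *: d)) d.
have dphi (t : R) : is_derive t 1 phi (dotv (jacob f (y + t *: d) *m d) d).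
  have := is_derive_dotv (is_derive_line y d t df) (is_derive_cst d t 1).
  by rewrite dotv0r addr0.
have cphi : {within `[0, 1], continuous phi}.
  by apply: derivable_within_continuous => t _; case: (dphi t).
have [c _] := MVT (@ltr01 R) (fun t _ => dphi t) cphi.
have yd : y + d = x by rewrite addrC subrK.
rewrite /phi scale1r scale0r addr0 subr0 mulr1 yd -dotvBl => ->.
by rewrite dotvC pf// subr_eq0.
Qed.

(** In the sup norm the sphere is a closed subset of a box, and the box is the transposed image of a
    compact box of row vectors. *)
Lemma compact_cV_sphere (R : realType) n (e : R) : compact [set d : 'cV[R]_n | `|d| = e].
Proof.
have cK : compact (trmx @` [set v : 'rV[R]_n | forall i, `[- e, e]%classic (v ord0 i)]).
  apply: continuous_compact; last first.
    by apply: (@rV_compact _ _ (fun=> `[- e, e]%classic)) => _; exact: segment_compact.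
  apply: continuous_subspaceT => v.
  apply: (@cvg_mx _ _ (nbhs v)) => i j.
  by under eq_fun do rewrite mxE; rewrite mxE; exact: coord_continuous.
apply: subclosed_compact cK _.
  have -> : [set d : 'cV[R]_n | `|d| = e] = Num.norm @^-1` [set e] by [].
  by apply: preimage_closed; [move=> d _; exact: norm_continuous|exact: closed_eq].
move=> d /= de; exists d^T; last by rewrite trmxK.
by move=> i; rewrite mxE /= in_itv/= -ler_norml -de mx_entry_le_norm.
Qed.

(* By strict monotonicity, f maps the sphere of radius e around g y outside of
   a neighborhood of y, and hence everything outside of that sphere too. *)
Lemma strictly_monotone_inverse_continuous (R : realType) n (f g : 'cV[R]_n -> 'cV[R]_n) :
  continuous f -> cancel g f ->
  (forall x y : 'cV[R]_n, x != y -> 0 < dotv (f x - f y) (x - y)) -> continuous g.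
Proof.
move=> cf gK mf y.
suff : g @ nbhs y --> g y by [].
apply/cvgrPdist_lt => e e0.
have mf0 (a b : 'cV[R]_n) : 0 <= dotv (f a - f b) (a - b).
  by have [->|/mf/ltW//] := eqVneq a b; rewrite !subrr dotv0r.
(* The ray from [g y] to a far away [g x] crosses the sphere at [g y + d]; [g x] lies further out by
   the factor [s]. *)
have onsphere x : e <= `|g y - g x| ->
    exists2 s : R, 1 <= s & exists2 d : 'cV[R]_n, `|d| = e & g x = g y + s *: d.
  move=> ex; have xy : `|g y - g x| != 0 by rewrite gt_eqF// (lt_le_trans e0).
  exists (`|g y - g x| / e); first by rewrite ler_pdivlMr// mul1r.
  exists ((`|g y - g x| / e)^-1 *: (g x - g y)).
    by rewrite normrZ (distrC (g x)) normfV normf_div normr_id (gtr0_norm e0) invf_div divfK.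
  by rewrite scalerA divff ?mulf_neq0 ?invr_eq0 ?(gt_eqF e0)// scale1r addrC subrK.
pose S := [set d : 'cV[R]_n | `|d| = e].
(* In dimension 0 the sphere is empty, so there is no minimum to take; but then no [g x] is far from
   [g y]. *)
have [S0|S0] := pselect (S !=set0); last first.
  apply: nearW => x; rewrite ltNge; apply/negP => /onsphere[s _ [d de _]].
  by apply: S0; exists d.
(* The minimum of [phi] on the sphere is positive and decides how close [x] has to be to [y]. *)
pose phi d := dotv (f (g y + d) - y) d.
have cphi : continuous phi.
  move=> d; apply: (@cvg_dotv _ _ (nbhs d) _ _ _ id) => //.
  apply: (@cvgB _ _ _ (nbhs d) _ (fun d => f (g y + d)) (cst y)); last exact: cvg_cst.
  apply: (@continuous_comp _ _ _ (fun d => g y + d) f); last exact: cf.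
  by apply: (@cvgD _ _ _ (nbhs d) _ (cst (g y)) id) => //; exact: cvg_cst.
have [d0 Sd0 mind0] := compact_EVT_min S0 (@compact_cV_sphere R n e)
  (continuous_subspaceT cphi).
have d00 : d0 != 0.
  by move: Sd0; rewrite inE /S/= -normr_gt0 => ->.
have m0 : 0 < phi d0.
  have := mf (g y + d0) (g y).
  by rewrite [g y + d0 - _]addrC addKr gK; apply; rewrite -subr_eq0 [g y + d0 - _]addrC addKr.
have ne0 : 0 < n%:R * e + 1 by rewrite ltr_wpDl// mulr_ge0// ltW.
near=> x.
rewrite ltNge; apply/negP => /onsphere[s s1 [d de gx]].
(* Monotonicity along the ray: going from [d] to [s *: d] does not decrease <f(g y + .), d>, and the
   end value of [f] is [f (g x) = x]. *)
have : phi d0 <= dotv (x - y) d.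
  apply: (le_trans (mind0 d _)); first by rewrite inE.
  rewrite /phi -subr_ge0 -dotvBl opprB addrA subrK -{1}(gK x) gx.
  move: s1; rewrite le_eqVlt => /predU1P[<-|s1].
    by rewrite scale1r subrr dotvC dotv0r.
  have := mf0 (g y + s *: d) (g y + d).
  have -> : g y + s *: d - (g y + d) = (s - 1) *: d.
    by rewrite opprD addrACA subrr add0r scalerBl scale1r.
  by rewrite dotvZr pmulr_rge0// subr_gt0.
apply/negP; rewrite -ltNge (le_lt_trans (ler_norm _))//.
rewrite (le_lt_trans (dotv_norm_le _ _))// de.
have : `|x - y| < phi d0 / (n%:R * e + 1).
  rewrite distrC; near: x; apply: cvgr_dist_lt; last exact: divr_gt0.
  exact: cvg_id.
rewrite ltr_pdivlMr// => /(le_lt_trans _); apply.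
rewrite mulrDr mulr1 mulrCA lerDl.
by [].
Unshelve. all: by end_near. Qed.

Lemma cvg_continuous_mx (R : realType) (T : Type) (F : set_system T) {FF : Filter F}
    m n p q (g : 'M[R]_(m, n) -> 'M[R]_(p, q)) (f : T -> 'M[R]_(m, n))
    (a : 'M[R]_(m, n)) :
  continuous g -> f @ F --> a -> g (f x) @[x --> F] --> g a.
Proof. by move=> cg fa; exact: (@cvg_comp _ _ _ f g F _ _ fa (cg a)). Qed.

(** Supplies the constant that dominates the derivative under the integral sign. *)
Lemma continuous_bounded_rectangle (R : realType) (F : R * R -> R) (a b c d : R) :
  continuous F ->
  exists2 M, 0 < M & forall x y, x \in `[a, b] -> y \in `[c, d] -> `|F (x, y)| <= M.
Proof.
move=> cF.
have : compact (F @` (`[a, b] `*` `[c, d])%classic).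
  apply: continuous_compact; first exact: continuous_subspaceT.
  by apply: compact_setX; exact: segment_compact.
move=> /compact_bounded/ex_strict_bound_gt0[M M0 FM].
exists M => // x y xab ycd; apply/ltW/FM => /=.
by exists (x, y).
Qed.

(** * Potential of a map with symmetric Jacobian *)

Section line_integral_potential.
Variables (R : realType) (n : nat) (f : 'cV[R]_n -> 'cV[R]_n).
Hypothesis C1f : C1_map f.
Hypothesis symf : forall x, (jacob f x)^T = jacob f x.

Let mu : {measure set (measurableTypeR R) -> \bar R} := @lebesgue_measure R.
(** With w = v + t h, this is the integrand of the line integral of [f] from 0 to w, parametrized by
    s; [dintegrand] is its derivative in t. *)
Let integrand (v h : 'cV[R]_n) (t s : R) : R :=
  dotv (f (s *: (v + t *: h))) (v + t *: h).
Let dintegrand (v h : 'cV[R]_n) (t s : R) : R :=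
  dotv (jacob f (s *: (v + t *: h)) *m (s *: h)) (v + t *: h)
  + dotv (f (s *: (v + t *: h))) h.

Let cf : continuous f.
Proof. by move=> x; apply: differentiable_continuous; exact: C1f.1. Qed.

Let is_derive_integrand v h (t s : R) :
  is_derive t 1 (fun t => integrand v h t s) (dintegrand v h t s).
Proof.
have lineE (r : R) : s *: (v + r *: h) = s *: v + r *: (s *: h).
  by rewrite scalerDr !scalerA (mulrC s).
have df := is_derive_line (s *: v) (s *: h) t C1f.1.
have dl : is_derive t 1 (fun t => v + t *: h) h.
  have did (x : 'cV[R]_n) : differentiable id x by [].
  by have := is_derive_line v h t did; rewrite jacob_mul// derive_id.
rewrite /dintegrand /integrand lineE.
under eq_fun do rewrite lineE.
exact: is_derive_dotv df dl.
Qed.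

Let cvg_line (v h : 'cV[R]_n) (T : Type) (F : set_system T) (FF : Filter F)
   (g : T -> R) (t : R) :
  g @ F --> t -> v + g x *: h @[x --> F] --> v + t *: h.
Proof. by move=> gt; apply: cvgD; [exact: cvg_cst|exact: cvgZr_tmp]. Qed.

Let continuous_integrand v h t : continuous (integrand v h t).
Proof.
move=> s; apply: (@cvg_dotv _ _ (nbhs s)); last exact: cvg_cst.
have cs : x *: (v + t *: h) @[x --> nbhs s] --> s *: (v + t *: h).
  by apply: cvgZr_tmp; exact: cvg_id.
exact: cvg_continuous_mx cf cs.
Qed.

Let continuous_dintegrand v h :
  continuous (fun ts : R * R => dintegrand v h ts.1 ts.2).
Proof.
move=> ts.
have cl : v + x.1 *: h @[x --> nbhs ts] --> v + ts.1 *: h.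
  by apply: cvg_line; exact: cvg_fst.
have csl : x.2 *: (v + x.1 *: h) @[x --> nbhs ts] --> ts.2 *: (v + ts.1 *: h).
  by apply: cvgZ cl; exact: cvg_snd.
apply: cvgD; last first.
  apply: cvg_dotv; last exact: cvg_cst.
  exact: cvg_continuous_mx cf csl.
apply: cvg_dotv cl; apply: cvg_mulmx.
  exact: cvg_continuous_mx C1f.2 csl.
by apply: cvgZr_tmp; exact: cvg_snd.
Qed.

(** Symmetry of the Jacobian makes [dintegrand] the s-derivative of s <f(s w), h>, so the
    fundamental theorem of calculus leaves the value at s = 1. *)
Let integral_dintegrand v h t :
  \int[mu]_(s in `[0, 1]) dintegrand v h t s = dotv (f (v + t *: h)) h.
Proof.
set w := v + t *: h.
pose B s := s * dotv (f (0 + s *: w)) h.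
have dB (s : R) : is_derive s 1 B (dintegrand v h t s).
  have df := is_derive_dotv (is_derive_line 0 w s C1f.1) (is_derive_cst h s 1).
  have := is_deriveM (is_derive_id s 1) df.
  rewrite dotv0r addr0 add0r => dB; apply: is_derive_eq dB _.
  rewrite /dintegrand -/w /GRing.scale/= mulr1; congr (_ + _).
  by rewrite -scalemxAr dotvZl !dotv_mull symf dotvC dotv_mull symf dotvC.
have cB : {within `[0, 1], continuous dintegrand v h t}.
  apply: continuous_subspaceT => s.
  have cp : (t, x) @[x --> nbhs s] --> (nbhs t, nbhs s).
    exact: (cvg_pair (f := cst t) (g := id) (cvg_cst t) cvg_id).
  exact: (@cvg_comp R (R * R)%type R (pair t) (fun ts => dintegrand v h ts.1 ts.2)
    (nbhs s) _ _ cp (@continuous_dintegrand v h (t, s))).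
have dB1 : derivable_oo_LRcontinuous B 0 1.
  have cB' s : {for s, continuous B}.
    by apply/differentiable_continuous/derivable1_diffP; case: (dB s).
  split; first by move=> s _; case: (dB s).
    exact/cvg_at_right_filter/cB'.
  exact/cvg_at_left_filter/cB'.
have B'E : {in `]0, 1[, derive1 B =1 dintegrand v h t}.
  by move=> s _; rewrite derive1E; case: (dB s).
rewrite /Rintegral (continuous_FTC2 ltr01 cB dB1 B'E) /=.
by rewrite /B mul1r mul0r subr0 scale1r add0r.
Qed.

(** Poincare lemma: W(v) is the integral of <f(s v), v> over s in [0, 1], differentiated under the
    integral sign. Derivatives along lines are enough to show that W is convex. *)
Lemma line_integral_potential :
  exists W : 'cV[R]_n -> R, forall v h (t : R),
    is_derive t 1 (fun t => W (v + t *: h)) (dotv (f (v + t *: h)) h).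
Proof.
exists (fun v => \int[mu]_(s in `[0, 1]) dotv (f (s *: v)) v) => v h t.
(* Domination is only required near [t]; the half-width 1 is arbitrary. *)
have [M M0 FM] := continuous_bounded_rectangle (t - 1) (t + 1) 0 1 (@continuous_dintegrand v h).
have part x s : partial1of2 (integrand v h) x s = dintegrand v h x s.
  by rewrite partial1of2E; case: (is_derive_integrand v h x s).
have It : (`]t - 1, t + 1[%classic : set R) t.
  by rewrite /= in_itv/= ltrBlDr !ltrDl ltr01.
have hi x : (`]t - 1, t + 1[%classic : set R) x ->
    mu.-integrable `[0, 1]%classic (EFin \o integrand v h x).
  move=> _; apply: continuous_compact_integrable; first exact: segment_compact.
  by apply: continuous_subspaceT; exact: continuous_integrand.
have hM : mu.-integrable `[0, 1]%classic (EFin \o (fun=> M)).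
  apply: continuous_compact_integrable; first exact: segment_compact.
  by apply: continuous_subspaceT; exact: cst_continuous.
have hd x s : (`]t - 1, t + 1[%classic : set R) x -> (`[0, 1]%classic : set R) s ->
    derivable (integrand v h ^~ s) x 1.
  by move=> _ _; case: (is_derive_integrand v h x s).
have hG x s : (`]t - 1, t + 1[%classic : set R) x -> (`[0, 1]%classic : set R) s ->
    `|partial1of2 (integrand v h) x s| <= M.
  move=> xI sI; rewrite part; apply: (FM x s) => //.
  exact: subset_itv_oo_cc xI.
have mI : measurable (`[0, 1]%classic : set (measurableTypeR R)) by exact: measurable_itv.
pose F x := \int[mu]_(s in `[0, 1]) integrand v h x s.
suff : is_derive t 1 F (dotv (f (v + t *: h)) h) by [].
apply: DeriveDef.
  exact: (derivable_under_integral mI It hi hd (fun=> ltW M0) hM hG).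
rewrite -derive1E (differentiation_under_integral mI It hi hd (fun=> ltW M0) hM hG).
rewrite -integral_dintegrand; apply: eq_Rintegral => s _.
exact: part.
Qed.

End line_integral_potential.

(** * Legendre transform and potential of the inverse map *)

Section inverse_potential.
Variables (R : realType) (n : nat) (f g : 'cV[R]_n -> 'cV[R]_n).
Hypothesis C1f : C1_map f.
Hypothesis symf : forall x, (jacob f x)^T = jacob f x.
Hypothesis posf : forall x (v : 'cV[R]_n), v != 0 -> 0 < dotv v (jacob f x *m v).
Hypothesis gK : cancel g f.

Let mono (x y : 'cV[R]_n) : 0 <= dotv (f x - f y) (x - y).
Proof.
have [->|xy] := eqVneq x y; first by rewrite !subrr dotv0r.
exact/ltW/(strictly_monotone_jacob C1f.1 posf).
Qed.

Let cg : continuous g.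
Proof.
apply: strictly_monotone_inverse_continuous gK _.
  by move=> x; apply: differentiable_continuous; exact: C1f.1.
exact: strictly_monotone_jacob C1f.1 posf.
Qed.

(** By the mean value theorem the increment of W is <f(v + c d), d> with 0 < c < 1; monotonicity,
    applied to the displacement c d and divided by c, compares it with <f(v), d>. *)
Let ex_potential_le :
  exists W : 'cV[R]_n -> R, forall v w, dotv (f v) (w - v) <= W w - W v.
Proof.
have [W dW] := line_integral_potential C1f symf.
exists W => v w; set d := w - v.
have cW : {within `[0, 1], continuous (fun t => W (v + t *: d))}.
  by apply: derivable_within_continuous => t _; case: (dW v d t).
have [c] := MVT (@ltr01 R) (fun t _ => dW v d t) cW.
rewrite in_itv/= scale1r scale0r addr0 subr0 mulr1 => /andP[c0 _].
have -> : v + d = w by rewrite addrC subrK.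
move=> ->; rewrite -subr_ge0 -dotvBl -(pmulr_rge0 _ c0) -dotvZr.
have := mono (v + c *: d) v.
by rewrite [v + _ - v]addrC addKr.
Qed.

(* H is the Legendre transform of a potential of f, so that no differentiability
   of g is needed. *)
Lemma inverse_potential : exists2 H : 'cV[R]_n -> R, C1_scalar H & grad H = g.
Proof.
have [W leW] := ex_potential_le.
pose H x := dotv x (g x) - W (g x).
(* This is the tangent inequality of W from [g y] to [g x]. Exchanging x and y gives [H_le], so the
   first-order remainder of H is squeezed between 0 and <g y - g x, y - x>, which is o(y - x) by
   continuity of [g]. *)
have H_ge x y : 0 <= H y - H x - dotv (g x) (y - x).
  have := leW (g y) (g x); rewrite gK /H !dotvBr !(dotvC (g x)); lra.
have H_le x y : H y - H x - dotv (g x) (y - x) <= dotv (g y - g x) (y - x).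
  have := H_ge y x; rewrite dotvBl !dotvBr; lra.
pose dH x : 'cV[R]_n -> R := dotv (g x).
have dH_lin x : linear (dH x).
  by move=> a u v; rewrite /dH dotvDr dotvZr.
(* The candidate differential is bundled as a linear map for [diff_unique]. *)
pose L x : {linear 'cV[R]_n -> R} :=
  HB.pack (dH x) (GRing.isLinear.Build _ _ _ _ _ (dH_lin x)).
have cL x : continuous (L x).
  by move=> y; apply: (@cvg_dotv _ _ (nbhs y) _ _ (cst (g x)) id) => //; exact: cvg_cst.
have expand (x : 'cV[R]_n) :
    (H : 'cV[R]_n -> R^o) \o shift x = cst (H x) + L x +o_ (0 : 'cV[R]_n) id.
  have cgx : g (h + x) @[h --> nbhs (0 : 'cV[R]_n)] --> g x.
    apply: (cvg_continuous_mx (f := fun h => h + x) cg).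
    rewrite -[X in _ --> X]add0r.
    by apply: (@cvgD _ _ _ (nbhs 0) _ id (cst x)) => //; exact: cvg_cst.
  have n1 : 0 < n%:R + 1 :> R by rewrite ltr_wpDl.
  apply/eqaddoP => e e0; near=> h.
  rewrite /= opprD addrA ger0_norm; last first.
    by have := H_ge x (h + x); rewrite addrK.
  have := H_le x (h + x); rewrite addrK => /le_trans; apply.
  rewrite (le_trans (ler_norm _))// (le_trans (dotv_norm_le _ _))// mulrA.
  rewrite ler_wpM2r//.
  have : `|g (h + x) - g x| <= e / (n%:R + 1).
    rewrite distrC; near: h; move/cvgrPdist_le : cgx; apply.
    exact: divr_gt0.
  rewrite ler_pdivlMr// mulrDr mulr1 mulrC; apply: le_trans.
  by rewrite lerDl.
have dHE x : 'd H x = L x :> ('cV[R]_n -> R) by exact: diff_unique.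
have dfH x : differentiable H x.
  by apply/diff_locallyP; rewrite dHE.
have gH : grad H = g.
  apply/funext => x; apply/colP => j; rewrite mxE deriveE// dHE.
  exact: dotv_delta.
by exists H => //; split => //; rewrite gH.
Unshelve. all: by end_near. Qed.

End inverse_potential.

(** * Derivatives along an interval and gradients *)

Section derivative_along_interval.
Variables (R : realType) (I : set R) (t : R).

(** The interval has a point c other than t, and the points between t and c accumulate at t. This is
    what makes derivatives along [I] unique. *)
Lemma time_interval_proper : time_interval I -> I t -> ProperFilter (within I t^').
Proof.
move=> [itvI [a [b [Ia Ib ab]]]] It.
apply: Build_ProperFilter_ex => A.
rewrite /within/= => /nbhs_ballP[e /= e0 eA].
have [c [Ic ct]] : exists c, I c /\ c != t.
  by have [<-|at_] := eqVneq a t; [exists b; rewrite gt_eqF|exists a].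
(* At distance [m] a point is strictly inside the ball and not beyond [c]. *)
pose m := Num.min (e / 2) `|c - t|.
have ct0 : 0 < `|c - t| by rewrite normr_gt0 subr_eq0.
have m0 : 0 < m by rewrite lt_min ct0 divr_gt0.
have me : m < e by rewrite /m gt_min; apply/orP; left; lra.
have mc : m <= `|c - t| by rewrite ge_min lexx orbT.
have [tc|tc] := ltP t c.
  exists (t + m); apply: eA => //=.
  - by rewrite /ball/= opprD addNKr normrN gtr0_norm.
  - by rewrite gt_eqF// ltrDl.
  - move: mc; rewrite gtr0_norm ?subr_gt0// => mc.
    by apply: (itvI t c) => //; apply/andP; split; lra.
have {}tc : c < t by rewrite lt_neqAle ct.
exists (t - m); apply: eA => //=.
- by rewrite /ball/= opprB addrCA subrr addr0 gtr0_norm.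
- by rewrite lt_eqF// gtrDl oppr_lt0.
- move: mc; rewrite ltr0_norm ?subr_lt0// => mc.
  by apply: (itvI c t) => //; apply/andP; split; lra.
Qed.

Lemma has_deriv_in_unique n (f : R -> 'cV[R]_n) (d d' : 'cV[R]_n) :
  time_interval I -> I t -> has_deriv_in I f t d -> has_deriv_in I f t d' -> d = d'.
Proof.
move=> tI It; have := time_interval_proper tI It => PF.
by apply: cvg_unique.
Qed.

Lemma has_deriv_in_cst n (c : 'cV[R]_n) : has_deriv_in I (fun=> c) t 0.
Proof.
rewrite /has_deriv_in subrr; under eq_fun do rewrite scaler0.
exact: cvg_cst.
Qed.

Lemma has_deriv_in_mulmx m n (A : 'M[R]_(m, n)) (f : R -> 'cV[R]_n) (d : 'cV[R]_n) :
  has_deriv_in I f t d -> has_deriv_in I (fun s => A *m f s) t (A *m d).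
Proof.
rewrite /has_deriv_in => fd.
under eq_fun do rewrite -mulmxBr scalemxAr.
apply: cvg_continuous_mx fd; exact: mulmx_continuous.
Qed.

Lemma has_deriv_inD n (f g : R -> 'cV[R]_n) (d d' : 'cV[R]_n) :
  has_deriv_in I f t d -> has_deriv_in I g t d' ->
  has_deriv_in I (fun s => f s + g s) t (d + d').
Proof.
rewrite /has_deriv_in => fd gd.
under eq_fun do rewrite opprD addrACA scalerDr.
exact: cvgD.
Qed.

Lemma has_deriv_in_eq n (f g : R -> 'cV[R]_n) (d : 'cV[R]_n) :
  I t -> (forall s, I s -> f s = g s) -> has_deriv_in I f t d -> has_deriv_in I g t d.
Proof.
move=> It fg; rewrite /has_deriv_in (fg t It); apply: cvg_trans.
apply: near_eq_cvg; rewrite near_withinE; apply: nearW => s Is.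
by rewrite fg.
Qed.

(** Blocks are extracted and reinserted by constant matrices, so linearity of the derivative
    suffices. *)
Lemma has_deriv_in_col_mx m n (f : R -> 'cV[R]_m) (g : R -> 'cV[R]_n)
    (d : 'cV[R]_m) (d' : 'cV[R]_n) :
  has_deriv_in I (fun s => col_mx (f s) (g s)) t (col_mx d d') <->
  has_deriv_in I f t d /\ has_deriv_in I g t d'.
Proof.
split=> [fg|[fd gd]].
  split.
    have := has_deriv_in_mulmx (A := row_mx 1%:M 0) fg.
    by under eq_fun do rewrite mul_row_col mul1mx mul0mx addr0;
       rewrite mul_row_col mul1mx mul0mx addr0.
  have := has_deriv_in_mulmx (A := row_mx 0 1%:M) fg.
  by under eq_fun do rewrite mul_row_col mul1mx mul0mx add0r;
     rewrite mul_row_col mul1mx mul0mx add0r.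
have := has_deriv_inD (has_deriv_in_mulmx (A := col_mx 1%:M 0) fd)
  (has_deriv_in_mulmx (A := col_mx 0 1%:M) gd).
by under eq_fun do rewrite !mul_col_mx !mul1mx !mul0mx add_col_mx addr0 add0r;
   rewrite !mul_col_mx !mul1mx !mul0mx add_col_mx addr0 add0r.
Qed.

End derivative_along_interval.

(** * Gradients of sums and of compositions with linear maps *)

Lemma C1_scalarD (R : realType) n (G H : 'cV[R]_n -> R) :
  C1_scalar G -> C1_scalar H ->
  C1_scalar (fun x => G x + H x) /\
  forall x, grad (fun x => G x + H x) x = grad G x + grad H x.
Proof.
move=> [dG cG] [dH cH].
have gE x : grad (fun x => G x + H x) x = grad G x + grad H x.
  apply/colP => j; rewrite !mxE.
  by rewrite -deriveD//; exact: diff_derivable.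
split=> //; split; first by move=> x; exact: differentiableD.
rewrite (_ : grad _ = fun x => grad G x + grad H x); last exact/funext.
by move=> x; apply: (@cvgD _ _ _ (nbhs x) _ (grad G) (grad H)); [exact: cG|exact: cH].
Qed.

Lemma C1_scalar_mulmx (R : realType) m n (A : 'M[R]_(m, n)) (H : 'cV[R]_m -> R) :
  C1_scalar H ->
  C1_scalar (fun x : 'cV[R]_n => H (A *m x)) /\
  forall x, grad (fun x : 'cV[R]_n => H (A *m x)) x = A^T *m grad H (A *m x).
Proof.
move=> [dH cH].
have dA (x : 'cV[R]_n) : differentiable (mulmx A : 'cV[R]_n -> 'cV[R]_m) x.
  by apply: linear_differentiable; exact: mulmx_continuous.
have gE x : grad (fun x : 'cV[R]_n => H (A *m x)) x = A^T *m grad H (A *m x).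
  apply/colP => j; rewrite !mxE deriveE; last exact: differentiable_comp.
  rewrite (diff_comp (dA x) (dH _)) /= diff_lin; last exact: mulmx_continuous.
  rewrite /= -colE.
  have -> : col j A = \sum_i A i j *: delta_mx i 0.
    rewrite [LHS]matrix_sum_delta; apply: eq_bigr => i _.
    by rewrite big_ord1 mxE.
  rewrite linear_sum; apply: eq_bigr => i _.
  by rewrite linearZ/= -deriveE// !mxE.
split=> //; split; first by move=> x; exact: differentiable_comp.
rewrite (_ : grad _ = fun x => A^T *m grad H (A *m x)); last exact/funext.
move=> x; apply: (cvg_continuous_mx (F := nbhs x) (g := mulmx A^T) (f := fun x => grad H (A *m x))).
  exact: mulmx_continuous.
by apply: (cvg_continuous_mx (F := nbhs x) (g := grad H) (f := mulmx A)) => //; exact: mulmx_continuous.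
Qed.

(** * The system of a subcircuit *)

(* inv_map f y = 0 if y has no preimage. *)
Definition inv_map (R : realType) n (f : 'cV[R]_n -> 'cV[R]_n) (y : 'cV[R]_n) :=
  xget 0 [set x | f x = y].

Lemma inv_mapP (R : realType) n (f : 'cV[R]_n -> 'cV[R]_n) :
  bijective f -> cancel f (inv_map f) /\ cancel (inv_map f) f.
Proof.
move=> [g fK gK].
have E : inv_map f = g.
  apply/funext => y; rewrite /inv_map; case: xgetP => [x _ /= <-|]; first by rewrite fK.
  by move=> /(_ (g y))[]; exact: gK.
by rewrite E.
Qed.

Section subcircuit_ph.
Variables (R : realType) (s : subcircuit R) (nl : nat) (Al : 'M[R]_(nv s, nl)).
Variable (b : bool).

(** The flag [b] tells whether this system takes over the coupling equation. [mult_mx] embeds mu,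
    which is lambda or a vector of length 0, into the coupling currents, so that the same formulas
    serve both cases. *)
Definition mult_dim : nat := if b then nl else 0.

Definition mult_mx : 'M[R]_(nl, mult_dim) :=
  match b return 'M[R]_(nl, if b then nl else 0%N) with true => 1%:M | false => 0 end.

(** A boolean read as a dimension, 0 or 1. *)
Definition const_dim : nat := conductance (s := s) 0 != 0.

Definition st_dim : nat :=
  (nC s + nL s) + (nv s + (nV s + (nC s + mult_dim))).

Definition st_q (x : 'cV[R]_st_dim) : 'cV[R]_(nC s) := usubmx (usubmx x).
Definition st_phi (x : 'cV[R]_st_dim) : 'cV[R]_(nL s) := dsubmx (usubmx x).
Definition st_e (x : 'cV[R]_st_dim) : 'cV[R]_(nv s) := usubmx (dsubmx x).
Definition st_jV (x : 'cV[R]_st_dim) : 'cV[R]_(nV s) := usubmx (dsubmx (dsubmx x)).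
Definition st_jC (x : 'cV[R]_st_dim) : 'cV[R]_(nC s) :=
  usubmx (dsubmx (dsubmx (dsubmx x))).
Definition st_mu (x : 'cV[R]_st_dim) : 'cV[R]_mult_dim :=
  dsubmx (dsubmx (dsubmx (dsubmx x))).

Definition mkst q phi e jV jC mu : 'cV[R]_st_dim :=
  col_mx (col_mx q phi) (col_mx e (col_mx jV (col_mx jC mu))).

Lemma mkstK (x : 'cV[R]_st_dim) :
  mkst (st_q x) (st_phi x) (st_e x) (st_jV x) (st_jC x) (st_mu x) = x.
Proof. by rewrite /mkst !vsubmxK. Qed.

(** Half of J = U - U^T. Its rows give j_C, A_L^T e and most of Kirchhoff's current law; the
    transpose adds the inductor currents and the remaining constraints. *)
Definition upper_J : 'M[R]_st_dim :=
  block_mx 0 (block_mx 0 (row_mx 0 (row_mx 1%:M 0)) (A_L s)^T 0)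
           0 (block_mx 0 (- row_mx (A_V s) (row_mx (A_C s) (Al *m mult_mx))) 0 0).

(** The coupling input enters Kirchhoff's current law if [b] is false, where it will be -lambda, and
    the coupling constraint if [b] is true, where it will be the voltages coming from the other
    subcircuits. *)
Definition input_B : 'M[R]_(st_dim, nl + (nI s + nV s + const_dim)) :=
  col_mx 0
    (col_mx (row_mx ((~~ b)%:R *: Al)
               (row_mx (row_mx (- A_I s) 0)
                  (- (A_R s *m conductance (s := s) 0) *m const_mx 1)))
    (col_mx (row_mx 0 (row_mx (row_mx 0 (- 1%:M)) 0))
    (col_mx 0 (row_mx mult_mx^T 0)))).

Definition effort (x : 'cV[R]_st_dim) : 'cV[R]_st_dim :=
  mkst (inv_map (@Defs.charge _ s) (st_q x)) (inv_map (@flux _ s) (st_phi x))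
    (st_e x) (st_jV x) (st_jC x) (st_mu x).

(** The shift by g(0) makes the map dissipative; [input_B] restores g(0) as a constant source. *)
Definition resist (v : 'cV[R]_st_dim) : 'cV[R]_st_dim :=
  mkst 0 0
    (A_R s *m (conductance ((A_R s)^T *m st_e v) - conductance (s := s) 0)) 0 0 0.

Definition circuit_ph :=
  PHSystem (block_mx 1%:M 0 0 0 : 'M[R]_st_dim) (upper_J - upper_J^T) input_B
    effort resist.

Lemma mult_mx_tr : mult_mx^T *m mult_mx = 1%:M.
Proof.
rewrite /mult_mx /mult_dim; case: b => /=; first by rewrite trmx1 mul1mx.
by apply/matrixP => -[].
Qed.

Lemma mkst_inj q phi e jV jC mu q' phi' e' jV' jC' mu' :
  mkst q phi e jV jC mu = mkst q' phi' e' jV' jC' mu' ->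
  [/\ q = q', phi = phi', e = e', jV = jV' & jC = jC' /\ mu = mu'].
Proof.
by move=> /eq_col_mx[/eq_col_mx[-> ->]] /eq_col_mx[-> /eq_col_mx[-> /eq_col_mx[-> ->]]].
Qed.

(** Here [q] and [phi] stand for efforts, that is capacitor voltages and inductor currents. *)
Lemma circuit_ph_rhs q phi e jV jC mu uhat cur vol :
  ph_J circuit_ph *m mkst q phi e jV jC mu - ph_r circuit_ph (mkst q phi e jV jC mu)
  + ph_B circuit_ph *m col_mx uhat (col_mx (col_mx cur vol) (const_mx 1)) =
  mkst jC ((A_L s)^T *m e)
   (- (A_V s *m jV + (A_C s *m jC + Al *m mult_mx *m mu)) - A_L s *m phi
    - A_R s *m (conductance ((A_R s)^T *m e) - conductance (s := s) 0)
    + ((~~ b)%:R *: (Al *m uhat) - A_I s *m cur - A_R s *m conductance (s := s) 0))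
   ((A_V s)^T *m e - vol) ((A_C s)^T *m e - q)
   (mult_mx^T *m (Al^T *m e + uhat)).
Proof.
(* If [const_dim] is 1, the ones multiply to 1; if it is 0, the product vanishes, but so does
   g(0). *)
have cE : A_R s *m conductance (s := s) 0 *m (const_mx 1 : 'rV[R]_const_dim)
    *m (const_mx 1 : 'cV[R]_const_dim) = A_R s *m conductance (s := s) 0.
  rewrite -mulmxA [X in _ *m X](_ : _ = const_dim%:R%:M); last first.
    apply/matrixP => i j; rewrite !ord1 !mxE eqxx mulr1n.
    by under eq_bigr do rewrite !mxE mulr1; rewrite sumr_const card_ord.
  rewrite mul_mx_scalar /const_dim; case: eqVneq => [->|_]/=; last by rewrite scale1r.
  by rewrite mulmx0 scaler0.
have eE : st_e (mkst q phi e jV jC mu) = e.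
  by rewrite /st_e /mkst col_mxKd col_mxKu.
rewrite /= /resist eE /upper_J /input_B /mkst mulmxBl.
rewrite !(tr_block_mx, tr_row_mx, trmx0, trmx1, trmxK, linearN) /=.
rewrite !(tr_row_mx).
rewrite !(mul_block_col, mul_row_col, mul_col_mx, mul0mx, mul1mx, addr0, add0r, mulNmx).
rewrite -scalemxAl cE.
rewrite !(opp_col_mx, add_col_mx, oppr0, subr0, addr0, add0r, opprK, col_mx0).
rewrite !addrA mulmxDr trmx_mul !mulmxA.
congr (col_mx _ (col_mx _ _)).
by rewrite opprB.
Qed.

Lemma has_deriv_in_mkst I q phi e jV jC mu (t : R) q' phi' e' jV' jC' mu' :
  has_deriv_in I (fun r => mkst (q r) (phi r) (e r) (jV r) (jC r) (mu r)) t
    (mkst q' phi' e' jV' jC' mu') <->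
  [/\ has_deriv_in I q t q', has_deriv_in I phi t phi', has_deriv_in I e t e',
      has_deriv_in I jV t jV' & has_deriv_in I jC t jC' /\ has_deriv_in I mu t mu'].
Proof.
split.
  case/has_deriv_in_col_mx => /has_deriv_in_col_mx[? ?].
  by case/has_deriv_in_col_mx => ? /has_deriv_in_col_mx[? /has_deriv_in_col_mx[? ?]].
case=> hq hphi he hjV [hjC hmu].
apply/has_deriv_in_col_mx; split; first exact/has_deriv_in_col_mx.
apply/has_deriv_in_col_mx; split => //.
by apply/has_deriv_in_col_mx; split => //; exact/has_deriv_in_col_mx.
Qed.

(** E annihilates the four lower blocks, whose derivatives are therefore 0; uniqueness of
    derivatives along [I] turns these rows into algebraic equations. *)
Lemma circuit_ph_solutionP I (uhat : R -> 'cV[R]_nl) (cur : R -> 'cV[R]_(nI s))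
    (vol : R -> 'cV[R]_(nV s)) (x : R -> 'cV[R]_st_dim) :
  time_interval I ->
  ph_solution circuit_ph I
    (fun t => col_mx (uhat t) (col_mx (col_mx (cur t) (vol t)) (const_mx 1))) x <->
  forall t, I t ->
    [/\ has_deriv_in I (st_q \o x) t (st_jC (x t)),
        has_deriv_in I (st_phi \o x) t ((A_L s)^T *m st_e (x t)),
        A_C s *m st_jC (x t) + A_R s *m conductance ((A_R s)^T *m st_e (x t))
          + A_L s *m inv_map (@Defs.flux _ s) (st_phi (x t)) + A_V s *m st_jV (x t)
          + A_I s *m cur t
          + (Al *m (mult_mx *m st_mu (x t)) - (~~ b)%:R *: (Al *m uhat t)) = 0,
        (A_V s)^T *m st_e (x t) = vol t
      & (A_C s)^T *m st_e (x t) = inv_map (@Defs.charge _ s) (st_q (x t)) /\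
        mult_mx^T *m (Al^T *m st_e (x t) + uhat t) = 0].
Proof.
move=> tI.
have EE : (fun r => ph_E circuit_ph *m x r) =
    (fun r => mkst (st_q (x r)) (st_phi (x r)) 0 0 0 0).
  apply/funext => r; rewrite -{1}[x r]mkstK /= /mkst mul_block_col.
  by rewrite mul1mx !mul0mx !addr0 !col_mx0.
(* The shift [g0] from [resist] cancels against the constant source. *)
have kcl m (v c l g g0 r u i : 'cV[R]_m) :
    (- (v + (c + l)) - r - (g - g0) + (u - i - g0) == 0) =
    (c + g + r + v + i + (l - u) == 0).
  rewrite -[RHS]oppr_eq0; congr (_ == 0).
  by apply/colP => k; rewrite !mxE; ring.
split=> sol t It; move/(_ t It): sol; rewrite EE circuit_ph_rhs.
  case/has_deriv_in_mkst => hq hphi he hjV [hjC hmu].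
  have he0 := has_deriv_in_unique tI It he (has_deriv_in_cst I t 0).
  have hjV0 := has_deriv_in_unique tI It hjV (has_deriv_in_cst I t 0).
  have hjC0 := has_deriv_in_unique tI It hjC (has_deriv_in_cst I t 0).
  have hmu0 := has_deriv_in_unique tI It hmu (has_deriv_in_cst I t 0).
  split => //.
  - by move/eqP: he0; rewrite mulmxBr kcl mulmxA => /eqP.
  - exact/subr0_eq.
  - by split => //; exact/subr0_eq.
case=> hq hphi /eqP kc hV [hC hmu].
have -> : - (A_V s *m st_jV (x t) + (A_C s *m st_jC (x t)
      + Al *m mult_mx *m st_mu (x t))) - A_L s *m inv_map (Defs.flux (s := s)) (st_phi (x t))
    - A_R s *m (conductance ((A_R s)^T *m st_e (x t)) - conductance (s := s) 0)
    + ((~~ b)%:R *: (Al *m uhat t) - A_I s *m cur t - A_R s *m conductance (s := s) 0) = 0.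
  by apply/eqP; rewrite mulmxBr kcl -mulmxA.
rewrite hV hC subrr subrr hmu.
apply/has_deriv_in_mkst; split => //; try split; exact: has_deriv_in_cst.
Qed.

Lemma circuit_ph_skew (v w : 'cV[R]_st_dim) :
  v^T *m ph_J circuit_ph *m w = - (w^T *m ph_J circuit_ph *m v).
Proof.
have sc (a : 'M[R]_1) : a^T = a by apply/matrixP => i j; rewrite mxE !ord1.
have tU (x y : 'cV[R]_st_dim) : x^T *m upper_J^T *m y = y^T *m upper_J *m x.
  by rewrite -[LHS]sc !trmx_mul !trmxK mulmxA.
by rewrite /= !mulmxBr !mulmxBl !tU opprB.
Qed.

Hypothesis pas : passive s.

(** The Hamiltonian is the stored energy: the potentials of the inverse charge and flux maps,
    composed with the projections [Q] and [F] onto q_C and phi_L. *)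
Lemma circuit_ph_dae : is_ph_dae circuit_ph.
Proof.
have [[bq C1q posq] [bf C1f posf] [C1g posg]] := pas.
have [_ Kq] := inv_mapP bq.
have [_ Kf] := inv_mapP bf.
have posd n (M : 'M[R]_n) (v : 'cV[R]_n) : posdef M -> v != 0 -> 0 < dotv v (M *m v).
  by move=> Mp v0; rewrite /dotv mulmxA Mp.
have [HC C1HC gHC] := inverse_potential C1q (fun x => (posq x).1)
  (fun x v => posd _ _ v (posq x).2) Kq.
have [HL C1HL gHL] := inverse_potential C1f (fun x => (posf x).1)
  (fun x v => posd _ _ v (posf x).2) Kf.
pose Q : 'M[R]_(nC s, st_dim) := row_mx (row_mx 1%:M 0) 0.
pose F : 'M[R]_(nL s, st_dim) := row_mx (row_mx 0 1%:M) 0.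
have [C1HQ gHQ] := C1_scalar_mulmx Q C1HC.
have [C1HF gHF] := C1_scalar_mulmx F C1HL.
have [C1H gH] := C1_scalarD C1HQ C1HF.
exists fullv, (fun x => HC (Q *m x) + HL (F *m x)); split => //; split.
- by move=> *; exact: memvf.
- by move=> v w _ _; exact: circuit_ph_skew.
- move=> v _.
  (* The dissipated power has the form <g(w) - g(0), w - 0>, so monotonicity of the conductance
     applies. *)
  have -> : (v^T *m ph_r circuit_ph v) 0 0 =
      dotv (conductance ((A_R s)^T *m st_e v) - conductance (s := s) 0)
        ((A_R s)^T *m st_e v - 0).
    rewrite subr0 dotvC dotv_mull trmxK /dotv /= -{1}[v]mkstK.
    by rewrite /resist /mkst !tr_col_mx !mul_row_col !mulmx0 addr0 !add0r addr0.
  have [->|v0] := eqVneq ((A_R s)^T *m st_e v) 0; first by rewrite !subrr dotv0r.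
  apply/ltW/strictly_monotone_jacob => //; first exact: C1g.1.
  (* A quadratic form depends only on the symmetric part of its matrix: the form of the Jacobian is
     half that of the symmetrized one. *)
  move=> x w w0; have := posd _ _ _ (posg x) w0.
  rewrite mulmxDl dotvDr -dotv_mull dotvC; lra.
- move=> x _; rewrite gH gHQ gHF gHC gHL.
  have -> : Q *m x = st_q x.
    by rewrite -{1}[x]mkstK !mul_row_col mul1mx !mul0mx !addr0.
  have -> : F *m x = st_phi x.
    by rewrite -{1}[x]mkstK !mul_row_col mul1mx !mul0mx addr0 add0r.
  rewrite /= tr_block_mx !tr_row_mx !trmx0 !trmx1 /effort /mkst mul_block_col.
  by rewrite !mul_col_mx !mul1mx !mul0mx !addr0 add_col_mx addr0 add_col_mx addr0 add0r.
Qed.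

End subcircuit_ph.

(** * Coupling *)

Section multiplier.
Variables (R : realType) (nl : nat).

Lemma mult_mx_false (b : bool) (mu : 'cV[R]_(mult_dim nl b)) : ~~ b -> mult_mx R nl b *m mu = 0.
Proof. by case: b mu => // mu _; rewrite mul0mx. Qed.

Lemma mult_mx_true (b : bool) : b -> mult_mx R nl b *m (mult_mx R nl b)^T = 1%:M.
Proof. by case: b => // _; rewrite trmx1 mulmx1. Qed.

(** The first term is zero when [b] is true, the second when [b] is false. *)
Lemma coupling_output_circuit_ph (s : subcircuit R) (Al : 'M[R]_(nv s, nl)) b
    (x : 'cV[R]_(st_dim s nl b)) :
  coupling_output (circuit_ph Al b) x =
  (~~ b)%:R *: (Al^T *m st_e x) + mult_mx R nl b *m st_mu x.
Proof.
rewrite /coupling_output /ph_output /= /input_B /effort /mkst.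
rewrite !(tr_col_mx, tr_row_mx, trmx0, trmxK, mul_row_col, mul_col_mx, mul0mx).
rewrite !(add0r, addr0, add_col_mx) col_mxKu.
by rewrite linearZ /= -scalemxAl.
Qed.

Definition coupling_mx k (l i j : 'I_k) : 'M[R]_nl :=
  if i == j then 0 else if j == l then 1%:M else if i == l then - 1%:M else 0.

Lemma coupling_mxP k (l : 'I_k) :
  is_coupling_matrix (mh := fun=> nl) (coupling_mx l).
Proof.
split.
- move=> i j a b ij; rewrite /coupling_mx (negbTE ij) !inE.
  case: ifP => _; first by rewrite !mxE; case: (a == b); rewrite eqxx ?orbT.
  by case: ifP => _; rewrite !mxE ?eqxx ?orbT//; case: (a == b); rewrite ?oppr0 eqxx ?orbT.
- by move=> i; rewrite /coupling_mx eqxx.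
rewrite tr_mxblock -mxblockN; apply/eq_mxblockP => i j; rewrite /coupling_mx eq_sym.
have [_|ij] := eqVneq i j; first by rewrite trmx0 oppr0.
have [il|_] := eqVneq i l; have [jl|_] := eqVneq j l.
- by rewrite il jl eqxx in ij.
- by rewrite trmx1 opprK.
- by rewrite linearN /= trmx1.
- by rewrite trmx0 oppr0.
Qed.

(** With the outputs for [y], the coupling equations force the input -lambda for i != l, and for l
    the sum of the voltages of the others. *)
Lemma sum_coupling_mx k (l i : 'I_k) (y : 'I_k -> 'cV[R]_nl) :
  \sum_(j | j != i) coupling_mx l i j *m y j =
  if i == l then - \sum_(j | j != l) y j else y l.
Proof.
case: eqVneq => [->|il].
  rewrite -sumrN; apply: eq_bigr => j jl.
  by rewrite /coupling_mx eq_sym (negbTE jl) eqxx mulNmx mul1mx.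
rewrite (bigD1 l) 1?eq_sym//= /coupling_mx (negbTE il) eqxx mul1mx big1 ?addr0//.
by move=> j /andP[ji jl]; rewrite eq_sym (negbTE ji) (negbTE jl) mul0mx.
Qed.

End multiplier.

(** * Equivalence of the coupled systems with the circuit equations *)

Section coupled_circuit_ph.
Variables (R : realType) (k : nat) (l : 'I_k) (cc : coupled_circuit R k).
Hypothesis pas : forall i, passive (sub cc i).

Let n i := st_dim (sub cc i) (nlam cc) (i == l).
Let S i := circuit_ph (A_lam cc i) (i == l).
Let C := @coupling_mx R (nlam cc) k l.
Let P i := mult_mx R (nlam cc) (i == l).

Let out_neq i x : i != l -> coupling_output (S i) x = (A_lam cc i)^T *m st_e x.
Proof.
move=> il; rewrite coupling_output_circuit_ph (mult_mx_false _ il).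
by rewrite il scale1r addr0.
Qed.

Let out_l x : coupling_output (S l) x = P l *m st_mu x.
Proof.
by rewrite coupling_output_circuit_ph [in ~~ _]eqxx scale0r add0r.
Qed.

Section solutions.
Variables (I : set R) (cur : forall i, R -> 'cV[R]_(nI (sub cc i)))
  (vol : forall i, R -> 'cV[R]_(nV (sub cc i))).
Hypothesis tI : time_interval I.

Let ph_sol (x : forall i, R -> 'cV[R]_(n i)) :=
  coupled_ph_solution (mh := fun=> nlam cc) S C I
    (external_input (fun i => const_mx 1 : 'cV_(const_dim (sub cc i))) cur vol) x.

(** The coupling inputs are determined by the outputs and can be eliminated: every current law
    receives lambda, and the constraint of system l becomes the coupling equation. *)
Lemma coupled_circuit_phP (x : forall i, R -> 'cV[R]_(n i)) :
  ph_sol x <-> forall t, I t ->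
    (forall i, let s := sub cc i in
      [/\ has_deriv_in I (@st_q _ _ _ _ \o x i) t (st_jC (x i t)),
        has_deriv_in I (@st_phi _ _ _ _ \o x i) t ((A_L s)^T *m st_e (x i t)),
        A_C s *m st_jC (x i t) + A_R s *m conductance ((A_R s)^T *m st_e (x i t))
          + A_L s *m inv_map (@Defs.flux _ s) (st_phi (x i t)) + A_V s *m st_jV (x i t)
          + A_I s *m cur i t + A_lam cc i *m (P l *m st_mu (x l t)) = 0,
        (A_V s)^T *m st_e (x i t) = vol i t
      & (A_C s)^T *m st_e (x i t) = inv_map (@Defs.charge _ s) (st_q (x i t))]) /\
    \sum_i (A_lam cc i)^T *m st_e (x i t) = 0.
Proof.
pose y t j := coupling_output (S j) (x j t).
(* System l finds lambda in its own state, the others receive it with opposite sign as input. *)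
have lamE i t uhat : uhat + \sum_(j | j != i) C i j *m y t j = 0 ->
    A_lam cc i *m (P i *m st_mu (x i t)) - (~~ (i == l))%:R *: (A_lam cc i *m uhat)
    = A_lam cc i *m (P l *m st_mu (x l t)).
  have [->|/eqP il] := pselect (i = l).
    by rewrite [in ~~ _]eqxx scale0r subr0.
  rewrite sum_coupling_mx ifN// il scale1r /y out_l => /addr0_eq <-.
  by rewrite (mult_mx_false _ il) mulmx0 add0r mulmxN.
have sumE t uhat : uhat + \sum_(j | j != l) C l j *m y t j = 0 ->
    (A_lam cc l)^T *m st_e (x l t) + uhat = \sum_i (A_lam cc i)^T *m st_e (x i t).
  rewrite sum_coupling_mx ifT// => /subr0_eq ->.
  by rewrite [RHS](bigD1 l)//=; congr (_ + _); apply: eq_bigr => j jl; exact: out_neq.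
split=> [[uhat [sol cpl]] t It|sol].
  split.
    move=> i; have [h1 h2 h3 h4 [h5 _]] := (circuit_ph_solutionP _ _ _ _ _ tI).1 (sol i) t It.
    split => //.
    by rewrite -(lamE _ _ _ (cpl i t It)).
  have [_ _ _ _ [_ h6]] := (circuit_ph_solutionP _ _ _ _ _ tI).1 (sol l) t It.
  rewrite -(sumE _ _ (cpl l t It)).
  (* The constraint is only known after multiplication by P_l^T, which P_l P_l^T = 1 undoes. *)
  by rewrite -[LHS]mul1mx -(mult_mx_true _ _ (eqxx l)) -mulmxA h6 mulmx0.
exists (fun i t => - \sum_(j | j != i) C i j *m y t j).
have cpl i t : - (\sum_(j | j != i) C i j *m y t j) + \sum_(j | j != i) C i j *m y t j = 0.
  exact: addNr.
split=> [i|i t _]; last exact: addNr.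
apply/(circuit_ph_solutionP _ _ _ _ _ tI) => t It.
have [/(_ i)[h1 h2 h3 h4 h5] h6] := sol t It.
split => //; first by rewrite (lamE _ _ _ (cpl i t)).
split => //.
have [il|/eqP il] := pselect (i = l); first by rewrite il sumE// h6 mulmx0.
(* For i != l the constraint has no rows, whatever the vector. *)
move: (_ + _) => w; rewrite /mult_mx.
by case: (i == l) il => // _; rewrite trmx0 mul0mx.
Qed.

End solutions.

(** From systems to circuit, j_C is the required derivative of the charge. Conversely, q_C and phi_L
    are the charge and flux of the circuit variables, and j_C is the derivative of the charge, hence
    unique. *)
Lemma coupled_circuit_ph_rewrites :
  rewrites_circuit l (fun i => const_mx 1 : 'cV_(const_dim (sub cc i))) S C.
Proof.
exists (fun i x => st_e x), (fun i x => inv_map (@Defs.flux _ (sub cc i)) (st_phi x)),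
  (fun i x => st_jV x), (fun x => P l *m st_mu x).
split; [exact: out_neq|exact: out_l|move=> I cur vol tI ph_sol].
have qK i : cancel (@Defs.charge _ (sub cc i)) (inv_map (@Defs.charge _ (sub cc i))) /\
    cancel (inv_map (@Defs.charge _ (sub cc i))) (@Defs.charge _ (sub cc i)).
  by apply: inv_mapP; have [[]] := pas i.
have fK i : cancel (@Defs.flux _ (sub cc i)) (inv_map (@Defs.flux _ (sub cc i))) /\
    cancel (inv_map (@Defs.flux _ (sub cc i))) (@Defs.flux _ (sub cc i)).
  by apply: inv_mapP; have [_ []] := pas i.
split=> [x /(coupled_circuit_phP _ _ tI) sol t It|e jL jV lam sol reads].
  have [eqs ->] := sol t It; split => // i s.
  have [hq hphi hk hV hC] := eqs i; split.
  - exists (st_jC (x i t)); split; last by rewrite hk.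
    apply: has_deriv_in_eq hq => // r Ir /=.
    by have [/(_ i)[_ _ _ _ ->] _] := sol r Ir; rewrite (qK i).2.
  - exists ((A_L s)^T *m st_e (x i t)); split; last by rewrite subrr.
    by apply: has_deriv_in_eq hphi => // r _ /=; rewrite (fK i).2.
  - by rewrite hV subrr.
pose capacitor_current i t (dq : 'cV[R]_(nC (sub cc i))) :=
  let s := sub cc i in
  has_deriv_in I (fun t => Defs.charge ((A_C s)^T *m e i t)) t dq /\
  0 = A_C s *m dq + A_R s *m conductance ((A_R s)^T *m e i t)
    + A_L s *m jL i t + A_V s *m jV i t + A_I s *m cur i t + A_lam cc i *m lam t.
(* The circuit equations give a derivative at each time separately; choice collects them into a
   function, with default 0 outside [I]. *)
have exdq i : {dq : R -> _ & forall t, I t -> @capacitor_current i t (dq t)}.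
  apply: (@choice _ _ (fun t d => I t -> @capacitor_current i t d)) => t.
  have [It|nIt] := pselect (I t); last by exists 0.
  have [/(_ i)[[dq hdq] _ _] _] := sol t It.
  by exists dq.
pose dq i := projT1 (exdq i).
have dqP i := projT2 (exdq i).
pose x i t : 'cV[R]_(n i) :=
  mkst (Defs.charge ((A_C (sub cc i))^T *m e i t)) (Defs.flux (jL i t)) (e i t) (jV i t)
    (dq i t) ((P i)^T *m lam t).
have xE i t : [/\ st_q (x i t) = Defs.charge ((A_C (sub cc i))^T *m e i t),
    st_phi (x i t) = Defs.flux (jL i t), st_e (x i t) = e i t, st_jV (x i t) = jV i t
  & st_jC (x i t) = dq i t /\ st_mu (x i t) = (P i)^T *m lam t].
  have := mkstK (x i t); rewrite {2}/x => /mkst_inj[-> -> -> ->[-> ->]].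
  by [].
have lamK t : P l *m ((P l)^T *m lam t) = lam t.
  by rewrite mulmxA (mult_mx_true _ _ (eqxx l)) mul1mx.
exists x; split.
- apply/(coupled_circuit_phP _ _ tI) => t It.
  have [eqs sum0] := sol t It; split; last first.
    by rewrite [RHS]sum0; apply: eq_bigr => i _; have [_ _ ->] := xE i t.
  move=> i s; have [-> -> -> -> [-> _]] := xE i t.
  have [_ _ _ _ [_ ->]] := xE l t.
  have [hq hk] := dqP i t It.
  have [_ [dphi [hphi hL]] hV] := eqs i.
  rewrite (qK i).1 (fK i).1 lamK.
  split => //.
  + by apply: has_deriv_in_eq hq => // r _ /=; have [->] := xE i r.
  + rewrite -(subr0_eq (esym hL)).
    by apply: has_deriv_in_eq hphi => // r _ /=; have [_ ->] := xE i r.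
  + exact/subr0_eq/esym.
- move=> t It; split=> [i|].
    by have [_ -> -> -> _] := xE i t; rewrite (fK i).1.
  by have [_ _ _ _ [_ ->]] := xE l t.
move=> x' /(coupled_circuit_phP _ _ tI) sol' rd i t It.
(* The charge is recovered from the capacitor constraint of the system, the flux from the read-out
   current. *)
have eqr r j (Ir : I r) : [/\ st_q (x' j r) = Defs.charge ((A_C (sub cc j))^T *m e j r),
    st_phi (x' j r) = Defs.flux (jL j r), st_e (x' j r) = e j r & st_jV (x' j r) = jV j r].
  have [/(_ j)[re rL rV] _] := rd r Ir.
  have [/(_ j)[_ _ _ _ hC] _] := sol' r Ir.
  split=> //; first by rewrite -re hC (qK j).2.
  by rewrite -rL (fK j).2.
rewrite -[LHS]mkstK; have [-> -> -> ->] := eqr t i It.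
rewrite /x; congr mkst.
  have [/(_ i)[hq _ _ _ _] _] := sol' t It.
  have [hq' _] := dqP i t It.
  apply: (has_deriv_in_unique tI It _ hq').
  by apply: (has_deriv_in_eq It _ hq) => r Ir /=; have [->] := eqr r i Ir.
have [il|/eqP il] := pselect (i = l).
  rewrite -[LHS]mul1mx -mult_mx_tr -mulmxA; congr (_ *m _).
  by rewrite il; have [_] := rd t It.
(* For i != l both sides are vectors of length 0. *)
move: (st_mu _); rewrite /P.
by case: (i == l) il => // _ mu; apply/matrixP => -[].
Qed.

End coupled_circuit_ph.

Theorem lemma16 (R : realType) (k : nat) (l : 'I_k) (cc : coupled_circuit R k)
    (k_ge2 : (2 <= k)%N) (l_last : l.+1 = k :> nat)
    (cc_sound : sound cc) (cc_passive : forall i, passive (sub cc i)) :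
  exists (n p nc : 'I_k -> nat) (c : forall i, 'cV[R]_(nc i))
         (S : forall i, ph_system R (n i) (p i)
                (nlam cc + (nI (sub cc i) + nV (sub cc i) + nc i)))
         (C : forall i j : 'I_k, 'M[R]_(nlam cc, nlam cc)),
    [/\ multiply_coupled_ph (mh := fun=> nlam cc) S C,
        forall i, conductance (s := sub cc i) 0 = 0 -> nc i = 0%N
      & rewrites_circuit l c S C].
Proof.
(* E is square, so state and effort have the same dimension. The constant source is 1, its strength
   being part of [input_B]. *)
exists (fun i => st_dim (sub cc i) (nlam cc) (i == l)),
  (fun i => st_dim (sub cc i) (nlam cc) (i == l)), (fun i => const_dim (sub cc i)),
  (fun i => const_mx 1), (fun i => circuit_ph (A_lam cc i) (i == l)),
  (@coupling_mx R (nlam cc) k l).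
split; last exact: coupled_circuit_ph_rewrites.
- split; last exact: coupling_mxP.
  by move=> i; exact: circuit_ph_dae.
- by move=> i g0; rewrite /const_dim g0 eqxx.
Qed.
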